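(* Let $\psi^{(A)}$ and $\psi^{(B)}$ be neighbor functions and let $\sigma^{(A)},\sigma^{(B)}$ be positive numbers. Then $\psi^{(A)}$ and $\psi^{(B)}$ are continuously differentiable almost everywhere. Set $\sigma^*=1$ and define $\psi^*$ by $$\frac{d\psi^*(x)}{dx}=\min\left(\frac{1}{\sigma^{(A)}}\frac{d\psi^{(A)}(x)}{dx},\ \frac{1}{\sigma^{(B)}}\frac{d\psi^{(B)}(x)}{dx}\right),\qquad \psi^*(x)=\int_0^x\frac{d\psi^*(s)}{ds}\,ds.$$ Then $\psi^*$ is a neighbor function, and for every $x\geq 0$ we have $I_{\psi^{(A)},\sigma^{(A)}}(x)\subseteq I_{\psi^*,\sigma^*}(x)$ and $I_{\psi^{(B)},\sigma^{(B)}}(x)\subseteq I_{\psi^*,\sigma^*}(x)$.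
   Context: A neighbor function is a function $\psi:\mathbb{R}_{\geq 0}\to\mathbb{R}$ that is (i) strictly increasing, (ii) continuous, (iii) concave, and (iv) such that $g(x)=\psi(e^{x})$ is convex as a function of $x\in\mathbb{R}$. For a neighbor function $\psi$, a number $\sigma\geq 0$ and $y\geq 0$, the uncertainty interval around $y$ is $I_{\psi,\sigma}(y)=\big[\psi^{-1}(\max(\psi(0),\psi(y)-\sigma)),\ \psi^{-1}(\psi(y)+\sigma)\big]$. *)

(* Defs.v *)
From HB Require Import structures.
From mathcomp Require Import all_boot all_order all_algebra.
From mathcomp Require Import all_classical all_reals all_analysis.
Set Implicit Arguments. Unset Strict Implicit. Unset Printing Implicit Defensive.
Import Order.TTheory GRing.Theory Num.Theory.
Import numFieldNormedType.Exports.
Local Open Scope classical_set_scope.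
Local Open Scope ring_scope.

Section Neighbor.
Variable R : realType.

(* psi : R_{>=0} -> R is modelled as psi : R -> R; only values on [0,+oo)
   are constrained/used. *)
Definition neighbor_fun (psi : R -> R) : Prop :=
  (forall x y : R, 0 <= x -> x < y -> psi x < psi y) /\
  {within `[0, +oo[, continuous psi} /\
  (forall x y t : R, 0 <= x -> 0 <= y -> 0 <= t -> t <= 1 ->
     (1 - t) * psi x + t * psi y <= psi ((1 - t) * x + t * y)) /\
  (forall x y t : R, 0 <= t -> t <= 1 ->
     psi (expR ((1 - t) * x + t * y)) <= (1 - t) * psi (expR x) + t * psi (expR y)).

(* the inverse of psi on [0,+oo) (well defined on the range of psi) *)
Definition neighbor_inv (psi : R -> R) (v : R) : R :=
  xget 0 [set z : R | 0 <= z /\ psi z = v].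

Definition uncertainty_interval (psi : R -> R) (sigma y : R) : set R :=
  `[neighbor_inv psi (Num.max (psi 0) (psi y - sigma)),
    neighbor_inv psi (psi y + sigma)].

Definition ae_C1 (psi : R -> R) : Prop :=
  exists N : set R, (@lebesgue_measure R).-negligible N /\
    (forall x : R, 0 < x -> ~ N x -> derivable psi x 1) /\
    {within [set x : R | 0 < x] `\` N, continuous derive1 psi}.

Definition psi_star (psiA psiB : R -> R) (sigmaA sigmaB : R) (x : R) : R :=
  Rintegral (@lebesgue_measure R) `[0, x]
    (fun s => Num.min (derive1 psiA s / sigmaA) (derive1 psiB s / sigmaB)).

End Neighbor.

(* Main.v *)
Require Import Defs.
From mathcomp Require Import all_boot all_order all_algebra.
From mathcomp Require Import all_classical all_reals all_analysis.
From mathcomp Require Import measurable_realfun ring lra.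
Set Implicit Arguments.
Unset Strict Implicit.
Unset Printing Implicit Defensive.
Import Order.TTheory GRing.Theory Num.Theory.
Import numFieldNormedType.Exports.
Local Open Scope classical_set_scope.
Local Open Scope ring_scope.

(** At a point x > 0, concavity of psi gives an affine upper bound of psi that
    is attained at x, and convexity of psi(e^u) a lower bound that is affine in
    ln. The two bounds must have the same slope, so psi is differentiable at x
    and
      psi'(x) x (ln y - ln x) <= psi y - psi x <= psi'(x) (y - x).
    Hence neighbor functions are exactly the functions, continuous on [0, +oo[,
    whose derivative on ]0, +oo[ is positive and nonincreasing with x psi'(x)
    nondecreasing. These conditions force psi' to be continuous, and they pass
    to positive multiples and to minima, so the integral of the minimum of two
    such slopes is again a neighbor function (psi' may blow up at 0, but it is
    integrable there because psi is continuous at 0). Dividing psi by sigma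
    reduces the uncertainty intervals to sigma = 1; there a function with the
    smaller derivative has the smaller increments, hence the larger intervals.
    Their endpoints are genuine preimages because the logarithmic lower bound
    makes every neighbor function unbounded. *)

Section ConvexFunctions.
Context {R : realType}.
Implicit Types (D : set R) (f g h : R -> R) (a b c d t x y z : R).

Lemma convex_functionP D f : convex_function D f <->
  forall x y t, D x -> D y -> 0 <= t -> t <= 1 ->
    f ((1 - t) * x + t * y) <= (1 - t) * f x + t * f y.
Proof.
split=> [cf x y t Dx Dy t0 t1|cf t x y /set_mem Dx /set_mem Dy].
  rewrite [X in f X]addrC [leRHS]addrC.
  exact: (cf (Itv01 t0 t1) y x (mem_set Dy) (mem_set Dx)).
have := cf _ _ t%:num Dy Dx (ge0 t) (le1 t).
rewrite [X in f X]addrC [leRHS]addrC; exact.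
Qed.

Lemma convex_function_chordP D f : convex_function D f <->
  forall x y z, D x -> D y -> x < z < y ->
    f z * (y - x) <= f x * (y - z) + f y * (z - x).
Proof.
split=> [/convex_functionP cf x y z Dx Dy /andP[xz zy]|chord].
  have yx : 0 < y - x by lra.
  have t0 : 0 <= (z - x) / (y - x) by rewrite divr_ge0//; lra.
  have t1 : (z - x) / (y - x) <= 1 by rewrite ler_pdivrMr//; lra.
  have := cf x y _ Dx Dy t0 t1.
  have -> : (1 - (z - x) / (y - x)) * x + (z - x) / (y - x) * y = z.
    by field; rewrite gt_eqF.
  have -> : (1 - (z - x) / (y - x)) * f x + (z - x) / (y - x) * f y =
      (f x * (y - z) + f y * (z - x)) / (y - x) by field; rewrite gt_eqF.
  by rewrite ler_pdivlMr.
apply/convex_functionP => x y t Dx Dy.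
rewrite le_eqVlt => /predU1P[<- _|t0].
  by rewrite subr0 !mul1r !mul0r !addr0.
rewrite le_eqVlt => /predU1P[->|t1].
  by rewrite subrr !mul0r !mul1r !add0r.
have [xy|yx|->] := ltgtP x y; last by rewrite -!mulrDl subrK !mul1r.
- have /(chord _ _ _ Dx Dy) : x < (1 - t) * x + t * y < y by nra.
  have : 0 < y - x by lra.
  nra.
- have /(chord _ _ _ Dy Dx) : y < (1 - t) * x + t * y < x by nra.
  have : 0 < x - y by lra.
  nra.
Qed.

Lemma convex_subgradient D f a b x : convex_function D f ->
  D a -> D b -> D x -> a < x < b ->
  exists d, forall y, D y -> d * (y - x) <= f y - f x.
Proof.
move=> /convex_function_chordP chord Da Db Dx /andP[ax xb].
pose slopes := [set (f x - f w) / (x - w) | w in D `&` [set w | w < x]].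
have slopes_le y : D y -> x < y -> ubound slopes ((f y - f x) / (y - x)).
  move=> Dy xy _ [w [Dw /= wx] <-].
  rewrite ler_pdivrMr ?subr_gt0// mulrAC ler_pdivlMr ?subr_gt0//.
  have /(chord _ _ _ Dw Dy) : w < x < y by rewrite wx.
  lra.
have slopes_sup : has_sup slopes.
  split; first by exists ((f x - f a) / (x - a)), a.
  by exists ((f b - f x) / (b - x)); exact: slopes_le.
exists (sup slopes) => y Dy; have [xy|yx|->] := ltgtP x y; last first.
- by rewrite !subrr mulr0.
- have : (f x - f y) / (x - y) <= sup slopes.
    by apply: sup_ubound; [exact: slopes_sup.2|exists y].
  rewrite ler_pdivrMr ?subr_gt0//; lra.
- rewrite -ler_pdivlMr ?subr_gt0//.
  by apply: sup_le_ub; [exact: slopes_sup.1|exact: slopes_le].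
Qed.

Lemma ndecr_derive1_convex D f : is_interval D ->
  {within D, continuous f} -> {in D° : set R, forall x, derivable f x 1} ->
  {in D° : set R &, {homo derive1 f : x y / x <= y}} -> convex_function D f.
Proof.
move=> itvD cf df ndf; apply/convex_function_chordP => x y z Dx Dy /andP[xz zy].
have Dz : D z by apply: (itvD _ _ Dx Dy); rewrite !ltW.
have mvt a b : D a -> D b -> a < b -> exists c,
    [/\ D° c, a < c < b & f b - f a = derive1 f c * (b - a)].
  move=> Da Db ab.
  have Dab : `[a, b] `<=` D by move=> w /=; rewrite in_itv/=; exact: itvD.
  have Dabi : `]a, b[ `<=` D°.
    by rewrite -(interior_itv_bnd a b true false); exact: interiorS.
  have dab w : w \in `]a, b[ -> is_derive w 1 f (derive1 f w).
    move=> wab; rewrite derive1E; apply/derivableP/df.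
    by rewrite inE; exact: Dabi.
  have [c cab fab] := MVT ab dab (continuous_subspaceW Dab cf).
  by exists c; split => //; exact: Dabi.
have [c [Dc /andP[_ cz] fxz]] := mvt _ _ Dx Dz xz.
have [e [De /andP[ze _] fzy]] := mvt _ _ Dz Dy zy.
have : derive1 f c <= derive1 f e by apply: ndf; rewrite ?inE//; lra.
have : 0 < (z - x) * (y - z) by rewrite mulr_gt0// subr_gt0.
nra.
Qed.

Lemma le_derive1_increment f g a x y :
  {within `[a, +oo[, continuous f} -> {within `[a, +oo[, continuous g} ->
  (forall z, a < z -> derivable f z 1) ->
  (forall z, a < z -> derivable g z 1) ->
  (forall z, a < z -> derive1 f z <= derive1 g z) ->
  a <= x -> x <= y -> f y - f x <= g y - g x.
Proof.
move=> cf cg df dg le_fg ax xy.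
suff : (g - f) x <= (g - f) y by rewrite !fctE; lra.
apply: ger0_derive1_ndecry ax xy => [z|z|]; last exact: within_continuousB.
  by rewrite in_itv/= andbT => az; apply: derivableB; [exact: dg|exact: df].
rewrite in_itv/= andbT => az; rewrite derive1E deriveB; [|exact: dg|exact: df].
by rewrite -!derive1E subr_ge0 le_fg.
Qed.

Lemma is_derive_squeeze f g h x d :
  (\forall y \near x, g y <= f y <= h y) -> g x = f x -> h x = f x ->
  is_derive x 1 g d -> is_derive x 1 h d -> is_derive x 1 f d.
Proof.
move=> gfh gx hx dg dh.
pose quot (k : R -> R) (t : R) : R := t^-1 *: (k (t *: 1 + x) - k x).
have quot_cvg k : is_derive x 1 k d -> quot k @ 0^' --> d.
  by move=> dk; rewrite -(@derive_val _ _ _ _ _ _ _ dk); exact: ex_derive.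
suff fd : quot f @ 0^' --> d.
  by apply: DeriveDef; [apply/cvg_ex; exists d|exact/cvg_lim].
have shift_cvg : t *: 1 + x @[t --> (0 : R)^'] --> x.
  rewrite -[X in _ --> X](_ : 0 *: 1 + x = x); last by rewrite scale0r add0r.
  apply: cvg_within_filter; apply: cvgD; last exact: cvg_cst.
  apply: cvgZr_tmp; exact: cvg_id.
move: (quot_cvg _ dg) (quot_cvg _ dh) => /cvgrPdist_le gd /cvgrPdist_le hd.
apply/cvgrPdist_le => e e0; near=> t.
have /andP[gf fh] : g (t *: 1 + x) <= f (t *: 1 + x) <= h (t *: 1 + x).
  by near: t; exact: (shift_cvg _ gfh).
have : `|d - quot g t| <= e by near: t; exact: gd.
have : `|d - quot h t| <= e by near: t; exact: hd.
rewrite /quot gx hx !ler_distl; set y := t *: 1 + x in gf fh *.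
have [t0|t0|t0] := ltgtP t 0.
- have : t^-1 *: (h y - f x) <= t^-1 *: (f y - f x).
    by rewrite ler_nM2l ?invr_lt0// lerD2r.
  have : t^-1 *: (f y - f x) <= t^-1 *: (g y - f x).
    by rewrite ler_nM2l ?invr_lt0// lerD2r.
  lra.
- have : t^-1 *: (f y - f x) <= t^-1 *: (h y - f x).
    by rewrite ler_pM2l ?invr_gt0// lerD2r.
  have : t^-1 *: (g y - f x) <= t^-1 *: (f y - f x).
    by rewrite ler_pM2l ?invr_gt0// lerD2r.
  lra.
- by move: gf fh; rewrite t0 invr0 !scale0r.
Unshelve. all: by end_near. Qed.

Lemma ln_le_affine_slope c d x : 0 < x ->
  (forall y, 0 < y -> c * (ln y - ln x) <= d * (y - x)) -> c = d * x.
Proof.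
move=> x0 le_cd; pose gap : R -> R := d *: id - c *: @ln R.
have gapE y : gap y = d * y - c * ln y by [].
have gap_derive y : 0 < y -> is_derive y 1 gap (d - c * y^-1).
  move=> y0; rewrite -[d in d - _]mulr1.
  by have := is_derive1_ln y0 => ?; exact: is_deriveB.
have gap_min : is_derive x 1 gap 0.
  apply: (@derive1_at_min _ gap 0 (x + 1)).
  - lra.
  - move=> y; rewrite in_itv/= => /andP[y0 _].
    by have /@ex_derive := gap_derive _ y0.
  - by rewrite in_itv/=; lra.
  - move=> y; rewrite in_itv/= => /andP[y0 _]; have := le_cd _ y0.
    rewrite !gapE; lra.
have := @derive_val _ _ _ _ _ _ _ gap_min.
rewrite (@derive_val _ _ _ _ _ _ _ (gap_derive _ x0)) => /eqP.
by rewrite subr_eq0 => /eqP ->; rewrite divfK// gt_eqF.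
Qed.

End ConvexFunctions.

Section Integrability.

Lemma ge0_integral_bigcup_le (d : measure_display) (T : measurableType d)
    (R : realType) (mu : {measure set T -> \bar R}) (A : (set T)^nat)
    (f : T -> \bar R) (M : \bar R) :
  nondecreasing_seq A -> (forall n, measurable (A n)) ->
  (forall n, measurable_fun (A n) f) -> (forall n x, A n x -> (0 <= f x)%E) ->
  (forall n, (\int[mu]_(x in A n) f x <= M)%E) ->
  (\int[mu]_(x in \bigcup_n A n) f x <= M)%E.
Proof.
move=> ndA mA mf f0 le_M.
have cvgA := ge0_nondecreasing_set_cvg_integral (mu := mu) ndA mA mf f0.
rewrite -(cvg_lim _ cvgA)//.
by apply: lime_le; [apply/cvg_ex; eexists; exact: cvgA|exact: nearW].
Qed.

Context {R : realType}.
Implicit Types (f : R -> R) (a b c d : R).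
Local Notation mu := (@lebesgue_measure R).

Lemma itvoo_bigcup_itvcc a b :
  `]a, b[%classic = \bigcup_n `[a + n.+1%:R^-1, b - n.+1%:R^-1]%classic.
Proof.
apply/seteqP; split=> [x|x [n _]]; rewrite /= !in_itv/= => /andP[ax xb].
  have : (\bigcup_n `[a + n.+1%:R^-1, b[%classic) x.
    by rewrite -itv_open_bnd_bigcup /= in_itv/= ax xb.
  move=> [n _]; rewrite /= in_itv/= => /andP[nx _].
  have : (\bigcup_m `]a, b - m.+1%:R^-1]%classic) x.
    by rewrite -itv_bnd_open_bigcup /= in_itv/= ax xb.
  move=> [m _]; rewrite /= in_itv/= => /andP[_ xm].
  exists (maxn n m) => //=; rewrite in_itv/=.
  have maxn_inv p : (p <= maxn n m)%N -> (maxn n m).+1%:R^-1 <= p.+1%:R^-1 :> R.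
    by move=> pnm; rewrite lef_pV2 ?posrE// ler_nat.
  apply/andP; split.
    by apply: le_trans nx; rewrite lerD2l maxn_inv// leq_maxl.
  by apply: (le_trans xm); rewrite lerB// maxn_inv// leq_maxr.
by rewrite (lt_le_trans _ ax) ?(le_lt_trans xb)// ?ltrDl ?gtrBl invr_gt0.
Qed.

Lemma integrable_itvoo_itvcc a b f :
  mu.-integrable `]a, b[ (EFin \o f) -> mu.-integrable `[a, b] (EFin \o f).
Proof.
move=> /integrableP[mf intf]; apply/integrableP; split.
  exact: emeasurable_fun_itv_cc mf.
by rewrite integral_itv_bndoo//; exact: measurableT_comp.
Qed.

Lemma integral_derive1_itvcc f a b c d : a < c -> c < d -> d < b ->
  {in `]a, b[, forall x, derivable f x 1} ->
  {in `]a, b[, continuous (derive1 f)} ->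
  (\int[mu]_(x in `[c, d]) (derive1 f x)%:E = (f d)%:E - (f c)%:E)%E.
Proof.
move=> ac cd db df cdf.
have cdab x : x \in `[c, d] -> x \in `]a, b[ by rewrite !in_itv/=; lra.
have cf : {within `[c, d], continuous f}.
  by apply: derivable_within_continuous => x /cdab /df.
apply: (continuous_FTC2 cd) _ _ (fun _ _ => erefl).
- by apply: continuous_in_subspaceT => x; rewrite inE/= => /cdab; exact: cdf.
- have /(continuous_within_itvP _ cd)[_ fc fd] := cf.
  split; [|exact: fc|exact: fd].
  by move=> x xcd; apply/df/cdab/subset_itv_oo_cc.
Qed.

Lemma ge0_integral_derive1_itvcc_le f a b c d : a < b -> a < c -> d < b ->
  {within `[a, b], continuous f} ->
  {in `]a, b[, forall x, derivable f x 1} ->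
  {in `]a, b[, continuous (derive1 f)} ->
  {in `]a, b[, forall x, 0 <= derive1 f x} ->
  (\int[mu]_(x in `[c, d]) (derive1 f x)%:E <= (f b - f a)%:E)%E.
Proof.
move=> ab ac db cf df cdf df0; have ndf := ger0_derive1_le_cc df df0 cf.
have [cd|dc] := ltP c d.
  rewrite (integral_derive1_itvcc ac cd db df cdf) -EFinB lee_fin lerB//;
    apply: ndf; rewrite ?in_itv/=; lra.
rewrite (_ : (\int[mu]_(x in _) _)%E = 0%E).
  by rewrite lee_fin subr_ge0; apply: ndf; rewrite ?in_itv/=; lra.
move: dc; rewrite le_eqVlt => /predU1P[->|dc].
  by rewrite set_itv1 integral_set1.
by rewrite set_itv_ge ?integral_set0// bnd_simp -ltNge.
Qed.

Lemma ge0_derive1_integrable f a b : a < b ->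
  {within `[a, b], continuous f} ->
  {in `]a, b[, forall x, derivable f x 1} ->
  {in `]a, b[, continuous (derive1 f)} ->
  {in `]a, b[, forall x, 0 <= derive1 f x} ->
  mu.-integrable `[a, b] (EFin \o derive1 f).
Proof.
move=> ab cf df cdf df0; apply: integrable_itvoo_itvcc.
have mdf : measurable_fun `]a, b[ (derive1 f).
  apply: subspace_continuous_measurable_fun => //.
  by apply: continuous_in_subspaceT => x; rewrite inE; exact: cdf.
pose A n : set R := `[a + n.+1%:R^-1, b - n.+1%:R^-1]%classic.
have subA n : A n `<=` `]a, b[.
  by rewrite itvoo_bigcup_itvcc; exact: bigcup_sup.
have ndA : nondecreasing_seq A.
  apply/nondecreasing_seqP => n; rewrite subsetEset.
  have : n.+2%:R^-1 <= n.+1%:R^-1 :> R by rewrite lef_pV2 ?posrE// ler_nat.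
  by move=> le_inv; apply: subset_itvScc; rewrite bnd_simp lerD2l ?lerN2.
apply/integrableP; split; first exact/measurable_EFinP.
apply: (@le_lt_trans _ _ (f b - f a)%:E); last exact: ltry.
rewrite [leLHS](_ : _ = \int[mu]_(x in `]a, b[) (derive1 f x)%:E)%E; last first.
  by apply: eq_integral => x; rewrite inE/= => /df0 ?; rewrite ger0_norm.
rewrite itvoo_bigcup_itvcc; apply: ge0_integral_bigcup_le => //.
- move=> n; apply/measurable_EFinP; exact: measurable_funS (subA n) mdf.
- by move=> n x /subA /df0; rewrite lee_fin.
- move=> n; apply: ge0_integral_derive1_itvcc_le ab _ _ cf df cdf df0.
    by rewrite ltrDl invr_gt0.
  by rewrite gtrBl invr_gt0.
Qed.

End Integrability.

Section NeighborFunctions.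
Context {R : realType}.
Implicit Types (psi phi f g : R -> R) (a b k v x y z sigma : R).
Local Notation mu := (@lebesgue_measure R).

Lemma neighbor_fun_convexP psi : neighbor_fun psi <->
  [/\ forall x y, 0 <= x -> x < y -> psi x < psi y,
      {within `[0, +oo[, continuous psi},
      convex_function (`[0, +oo[ : set R) (\- psi) &
      convex_function [set: R] (psi \o expR)].
Proof.
have concE : convex_function (`[0, +oo[ : set R) (\- psi) <->
    forall x y t, 0 <= x -> 0 <= y -> 0 <= t -> t <= 1 ->
      (1 - t) * psi x + t * psi y <= psi ((1 - t) * x + t * y).
  split=> [/convex_functionP conc x y t x0 y0 t0 t1|conc].
    have := conc x y t; rewrite /= !in_itv/= !andbT => /(_ x0 y0 t0 t1); lra.
  apply/convex_functionP => x y t /=; rewrite !in_itv/= !andbT.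
  move=> x0 y0 t0 t1; have := conc x y t x0 y0 t0 t1; lra.
split=> [[incr [cpsi [/concE conc conv]]]|[incr cpsi /concE conc]].
  by split=> //; apply/convex_functionP => x y t _ _; exact: conv.
move=> /convex_functionP conv; split=> //; split=> //; split=> //.
by move=> x y t; exact: conv.
Qed.

Lemma neighbor_fun_tangent psi x : neighbor_fun psi -> 0 < x ->
  [/\ derivable psi x 1,
      forall y, 0 <= y -> psi y - psi x <= derive1 psi x * (y - x) &
      forall y, 0 < y ->
        derive1 psi x * x * (ln y - ln x) <= psi y - psi x].
Proof.
move=> /neighbor_fun_convexP[_ _ conc conv] x0.
have [d le_d] : exists d, forall y, 0 <= y -> psi y - psi x <= d * (y - x).
  have [||||d dP] := convex_subgradient (a := 0) (b := x + 1) (x := x) conc;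
    rewrite /= ?in_itv/= ?andbT; try lra.
  exists (- d) => y y0; have := dP y; rewrite /= in_itv/= andbT => /(_ y0); lra.
have [c ge_c] : exists c, forall y, 0 < y ->
    c * (ln y - ln x) <= psi y - psi x.
  have [||||c cP] := convex_subgradient (a := ln x - 1) (b := ln x + 1)
    (x := ln x) conv => //; first lra.
  by exists c => y y0; have := cP (ln y) I; rewrite /= !lnK ?posrE.
have cdx : c = d * x.
  apply: ln_le_affine_slope => // y y0.
  by apply: (le_trans (ge_c _ y0)); apply: le_d; exact: ltW.
have dpsi : is_derive x 1 psi d.
  apply: (is_derive_squeeze (g := fun y => psi x + c * (ln y - ln x))
    (h := fun y => psi x + d * (y - x))); rewrite ?subrr ?mulr0 ?addr0//.
  - near=> y; have y0 : 0 < y by near: y; exact: lt_nbhsr.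
    have := ge_c _ y0; have := le_d _ (ltW y0); lra.
  - have ? := is_derive1_ln x0.
    rewrite -[X in is_derive _ _ _ X](_ : 0 + c *: (x^-1 - 0) = d).
      exact: (is_deriveD (f := cst _) (g := c *: (@ln R - cst (ln x)))).
    by rewrite add0r subr0 cdx [_ *: _]mulfK// gt_eqF.
  - rewrite -[X in is_derive _ _ _ X](_ : 0 + d *: (1 - 0) = d).
      exact: (is_deriveD (f := cst _) (g := d *: (id - cst x))).
    by rewrite add0r subr0 [_ *: _]mulr1.
rewrite derive1E derive_val; split=> //.
by rewrite -cdx.
Unshelve. all: by end_near. Qed.

(* [f] nonincreasing is concavity of a primitive [psi] of [f], and [x * f x],
   the derivative of [psi \o expR] at [ln x], nondecreasing is convexity of
   [psi \o expR]. *)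
Definition neighbor_slope f :=
  [/\ forall x, 0 < x -> 0 < f x,
      forall x y, 0 < x -> x <= y -> f y <= f x &
      forall x y, 0 < x -> x <= y -> x * f x <= y * f y].

Lemma eq_neighbor_slope f g : (forall x, 0 < x -> f x = g x) ->
  neighbor_slope f -> neighbor_slope g.
Proof.
move=> fg [f0 nif ndxf]; split=> [x x0|x y x0 xy|x y x0 xy].
- by rewrite -fg// f0.
- by rewrite -!fg//; [exact: nif|lra].
- by rewrite -!fg//; [exact: ndxf|lra].
Qed.

Lemma neighbor_slope_div f k : 0 < k ->
  neighbor_slope f -> neighbor_slope (fun x => f x / k).
Proof.
move=> k0 [f0 nif ndxf]; split=> [x x0|x y x0 xy|x y x0 xy].
- by rewrite divr_gt0// f0.
- by rewrite ler_pM2r ?invr_gt0// nif.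
- by rewrite !mulrA ler_pM2r ?invr_gt0// ndxf.
Qed.

Lemma neighbor_slope_min f g : neighbor_slope f -> neighbor_slope g ->
  neighbor_slope (fun x => Num.min (f x) (g x)).
Proof.
move=> [f0 nif ndxf] [g0 nig ndxg]; split=> [x x0|x y x0 xy|x y x0 xy].
- by rewrite lt_min f0//= g0.
- by rewrite le_min !ge_min nif//= nig// orbT.
- have y0 : 0 <= y by lra.
  by rewrite !minr_pMr ?(ltW x0)// le_min !ge_min ndxf//= ndxg// orbT.
Qed.

Lemma neighbor_slope_continuous f x : neighbor_slope f -> 0 < x ->
  {for x, continuous f}.
Proof.
move=> [f0 nif ndxf] x0; pose hyp y := x * f x / y.
have hyp_cvg : {for x, continuous hyp}.
  by apply: cvgM; [exact: cvg_cst|apply: cvgV; [rewrite gt_eqF|exact: cvg_id]].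
have hypx : hyp x = f x by rewrite /hyp mulrC mulKf// gt_eqF.
apply: (@squeeze_cvgr _ (nbhs x) _ _ (cst (f x) \min hyp) (cst (f x) \max hyp)).
- near=> y; have y0 : 0 < y by near: y; exact: lt_nbhsr.
  rewrite /= ge_min le_max /hyp ler_pdivlMr// ler_pdivrMr// [f y * y]mulrC.
  have [xy|/ltW yx] := leP x y; first by rewrite (nif x y)// (ndxf x y)// orbT.
  by rewrite (nif y x)// (ndxf y x)// orbT.
- rewrite -[X in _ --> X](_ : (cst (f x) \min hyp) x = f x).
    by apply: continuous_min => //; exact: cvg_cst.
  by rewrite /= hypx minxx.
- rewrite -[X in _ --> X](_ : (cst (f x) \max hyp) x = f x).
    by apply: continuous_max => //; exact: cvg_cst.
  by rewrite /= hypx maxxx.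
Unshelve. all: by end_near. Qed.

Lemma neighbor_fun_slope psi : neighbor_fun psi -> neighbor_slope (derive1 psi).
Proof.
move=> npsi; have tangent := neighbor_fun_tangent npsi.
split=> [x x0|x y x0|x y x0].
- have [_ /(_ (x + 1)) le_psi _] := tangent _ x0.
  have /npsi.1 : 0 <= x by exact: ltW.
  move=> /(_ (x + 1)); lra.
- rewrite le_eqVlt => /predU1P[->//|xy]; have y0 : 0 < y by lra.
  have [_ /(_ _ (ltW y0)) le_x _] := tangent _ x0.
  have [_ /(_ _ (ltW x0)) le_y _] := tangent _ y0.
  have : 0 < y - x by lra.
  nra.
- rewrite le_eqVlt => /predU1P[->//|xy]; have y0 : 0 < y by lra.
  have [_ _ /(_ _ y0) ge_x] := tangent _ x0.
  have [_ _ /(_ _ x0) ge_y] := tangent _ y0.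
  have : 0 < ln y - ln x by rewrite subr_gt0 ltr_ln.
  nra.
Qed.

Lemma neighbor_fun_slopeP psi : neighbor_fun psi <->
  [/\ {within `[0, +oo[, continuous psi},
      forall x, 0 < x -> derivable psi x 1 & neighbor_slope (derive1 psi)].
Proof.
split=> [npsi|[cpsi dpsi [slope_gt0 slope_ni slope_nd]]].
  split; [exact: npsi.2.1| |exact: neighbor_fun_slope].
  by move=> x /(neighbor_fun_tangent npsi)[].
apply/neighbor_fun_convexP; split=> //.
- move=> x y x0 xy; apply: (@gtr0_derive1_lt_cc _ psi x y);
    rewrite ?in_itv/= ?lexx ?(ltW xy)//.
  + by move=> z; rewrite in_itv/= => /andP[xz _]; apply: dpsi; lra.
  + by move=> z; rewrite in_itv/= => /andP[xz _]; apply: slope_gt0; lra.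
  + apply: continuous_subspaceW cpsi => z /=; rewrite !in_itv/= andbT; lra.
- apply: (@ndecr_derive1_convex R `[0, +oo[ (\- psi)).
  + exact: interval_is_interval.
  + by move=> x; exact/continuousN/cpsi.
  + rewrite interior_itv => x; rewrite inE/= in_itv/= andbT => x0.
    exact/derivableN/dpsi.
  + rewrite interior_itv => x y; rewrite !inE/= !in_itv/= !andbT => x0 y0 xy.
    by rewrite !derive1N; [rewrite lerN2 slope_ni|exact: dpsi|exact: dpsi].
- have dexp u : derivable (psi \o expR) u 1.
    apply/derivable1_diffP/differentiable_comp; apply/derivable1_diffP => //.
    exact/dpsi/expR_gt0.
  apply: (@ndecr_derive1_convex R setT (psi \o expR)) => //.
  + apply: continuous_subspaceT => u.
    exact/differentiable_continuous/derivable1_diffP.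
  + have dcomp u : derive1 (psi \o expR) u = expR u * derive1 psi (expR u).
      rewrite derive1_comp//; last exact/dpsi/expR_gt0.
      by rewrite mulrC; congr (_ * _); rewrite derive1E derive_val.
    by move=> u v _ _ uv; rewrite !dcomp slope_nd ?expR_gt0 ?ler_expR.
Qed.

Lemma neighbor_fun_derive1_integrable psi b : neighbor_fun psi -> 0 < b ->
  mu.-integrable `[0, b] (EFin \o derive1 psi).
Proof.
move=> npsi b0; have slope := neighbor_fun_slope npsi.
have [cpsi dpsi [slope_gt0 _ _]] := (neighbor_fun_slopeP psi).1 npsi.
have pos x : x \in `]0, b[ -> 0 < x by rewrite in_itv/= => /andP[].
apply: ge0_derive1_integrable b0 _ _ _ _.
- apply: continuous_subspaceW cpsi; exact: subset_itvl.
- by move=> x /pos; exact: dpsi.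
- by move=> x /pos; exact: neighbor_slope_continuous.
- by move=> x /pos/slope_gt0/ltW.
Qed.

Lemma neighbor_slope_le_integrable f psi b : neighbor_slope f ->
  neighbor_fun psi -> (forall x, 0 < x -> f x <= derive1 psi x) -> 0 < b ->
  mu.-integrable `[0, b] (EFin \o f).
Proof.
move=> slope npsi le_f b0; apply: integrable_itvoo_itvcc.
have intpsi : mu.-integrable `]0, b[ (EFin \o derive1 psi).
  apply: integrableS (neighbor_fun_derive1_integrable npsi b0) => //.
  exact: subset_itv_oo_cc.
apply: le_integrable intpsi => //.
  apply/measurable_EFinP; apply: subspace_continuous_measurable_fun => //.
  apply: continuous_in_subspaceT => x; rewrite inE/= in_itv/= => /andP[x0 _].
  exact: neighbor_slope_continuous.
move=> x /=; rewrite in_itv/= => /andP[x0 _]; rewrite lee_fin.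
have f0 : 0 < f x by have [+ _ _] := slope; exact.
by rewrite !gtr0_norm ?(lt_le_trans f0)// le_f.
Qed.

Lemma neighbor_slope_derive1_Rintegral f x : neighbor_slope f -> 0 < x ->
  (forall b, 0 < b -> mu.-integrable `[0, b] (EFin \o f)) ->
  derivable (fun x => Rintegral mu `[0, x] f) x 1 /\
  derive1 (fun x => Rintegral mu `[0, x] f) x = f x.
Proof.
move=> slope x0 intf; have xx1 : x < x + 1 by rewrite ltrDl.
apply: (continuous_FTC1_closed xx1 (intf _ _) x0); first lra.
exact: neighbor_slope_continuous.
Qed.

Lemma neighbor_slope_Rintegral f : neighbor_slope f ->
  (forall b, 0 < b -> mu.-integrable `[0, b] (EFin \o f)) ->
  neighbor_fun (fun x => Rintegral mu `[0, x] f).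
Proof.
move=> slope intf; apply/neighbor_fun_slopeP.
have FTC x (x0 : 0 < x) := neighbor_slope_derive1_Rintegral slope x0 intf.
split=> [|x /FTC[]//|]; last first.
  by apply: eq_neighbor_slope slope => x /FTC[].
apply/continuous_within_itvcyP; split=> [x|].
  rewrite in_itv/= andbT => /FTC[+ _].
  by move=> /derivable1_diffP/differentiable_continuous.
have := parameterized_integral_continuous (@ler01 R) (intf _ ltr01).
by move=> /(continuous_within_itvP _ (@ltr01 R))[].
Qed.

Lemma neighbor_fun_ae_C1 psi : neighbor_fun psi -> ae_C1 psi.
Proof.
move=> /neighbor_fun_slopeP[_ dpsi slope]; exists set0.
split; first exact: negligible_set0.
split=> [x x0 _|]; first exact: dpsi.
rewrite setD0; apply: continuous_in_subspaceT => x; rewrite inE/=.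
exact: neighbor_slope_continuous.
Qed.

Lemma neighbor_fun_le psi x y : neighbor_fun psi -> 0 <= x -> 0 <= y ->
  (psi x <= psi y) = (x <= y).
Proof.
move=> [incr _] x0 y0; have [xy|yx|->] := ltgtP x y; last by rewrite lexx.
  by rewrite ltW// incr.
by apply/negbTE; rewrite -ltNge incr.
Qed.

Lemma neighbor_fun_surj psi v : neighbor_fun psi -> psi 0 <= v ->
  exists2 z, 0 <= z & psi z = v.
Proof.
move=> npsi v0; pose slope1 := derive1 psi 1.
have slope1_gt0 : 0 < slope1 by have [+ _ _] := neighbor_fun_slope npsi; exact.
pose b := expR ((v - psi 1) / slope1).
have vb : v <= psi b.
  have [_ _ /(_ b (expR_gt0 _))] := neighbor_fun_tangent npsi ltr01.
  by rewrite ln1 subr0 mulr1 expRK mulrC divfK ?gt_eqF//; lra.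
have cpsi : {within `[0, b], continuous psi}.
  by apply: continuous_subspaceW npsi.2.1; exact: subset_itvl.
have [|z] := IVT (expR_ge0 _) cpsi (v := v).
  by rewrite ge_min v0/= le_max vb orbT.
by rewrite in_itv/= => /andP[z0 _]; exists z.
Qed.

Lemma neighbor_invP psi v : neighbor_fun psi -> psi 0 <= v ->
  0 <= neighbor_inv psi v /\ psi (neighbor_inv psi v) = v.
Proof.
move=> npsi v0; have [z z0 psiz] := neighbor_fun_surj npsi v0.
exact: (@xgetI _ 0 [set z | 0 <= z /\ psi z = v] z (conj z0 psiz)).
Qed.

Lemma neighbor_inv_le psi v z : neighbor_fun psi -> psi 0 <= v -> 0 <= z ->
  (neighbor_inv psi v <= z) = (v <= psi z).
Proof.
move=> npsi v0 z0; have [inv0 invK] := neighbor_invP npsi v0.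
by rewrite -(neighbor_fun_le npsi)// invK.
Qed.

Lemma neighbor_inv_ge psi v z : neighbor_fun psi -> psi 0 <= v -> 0 <= z ->
  (z <= neighbor_inv psi v) = (psi z <= v).
Proof.
move=> npsi v0 z0; have [inv0 invK] := neighbor_invP npsi v0.
by rewrite -(neighbor_fun_le npsi)// invK.
Qed.

Lemma neighbor_inv_div psi k v : 0 < k ->
  neighbor_inv (fun x => psi x / k) (v / k) = neighbor_inv psi v.
Proof.
move=> k0; rewrite /neighbor_inv; congr xget.
apply/seteqP; split=> z /= [z0]; last by move=> ->.
by move=> /divIf; rewrite gt_eqF// => /(_ isT) ->.
Qed.

Lemma uncertainty_interval_div psi sigma x : 0 < sigma ->
  uncertainty_interval (fun y => psi y / sigma) 1 x =
  uncertainty_interval psi sigma x.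
Proof.
move=> sigma0; rewrite /uncertainty_interval.
have -> : 1 = sigma / sigma by rewrite divff ?gt_eqF.
rewrite -mulrBl -mulrDl -maxr_pMl ?invr_ge0 ?(ltW sigma0)//.
by rewrite !neighbor_inv_div.
Qed.

Lemma neighbor_fun_derive1_div psi k x : neighbor_fun psi -> 0 < x ->
  derive1 (fun y => psi y / k) x = derive1 psi x / k.
Proof.
by move=> npsi /(neighbor_fun_tangent npsi)[dpsi _ _]; exact: derive1Mr.
Qed.

Lemma neighbor_fun_div psi k : neighbor_fun psi -> 0 < k ->
  neighbor_fun (fun x => psi x / k).
Proof.
move=> npsi k0; have [cpsi dpsi slope] := (neighbor_fun_slopeP psi).1 npsi.
apply/neighbor_fun_slopeP; split.
- by move=> x; apply: cvgMr_tmp; exact: cpsi.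
- move=> x x0; apply: derivableM; [exact: dpsi|exact: derivable_cst].
- apply: eq_neighbor_slope (neighbor_slope_div k0 slope) => x x0.
  by rewrite neighbor_fun_derive1_div.
Qed.

Lemma uncertainty_interval_subset psi phi sigma x :
  neighbor_fun psi -> neighbor_fun phi -> 0 <= sigma -> 0 <= x ->
  (forall y, 0 < y -> derive1 phi y <= derive1 psi y) ->
  uncertainty_interval psi sigma x `<=` uncertainty_interval phi sigma x.
Proof.
move=> npsi nphi sigma0 x0 le_slope.
have [cpsi dpsi _] := (neighbor_fun_slopeP psi).1 npsi.
have [cphi dphi _] := (neighbor_fun_slopeP phi).1 nphi.
have le_inc := le_derive1_increment cphi cpsi dphi dpsi le_slope.
have lo_ge0 f : f 0 <= Num.max (f 0) (f x - sigma) by rewrite le_max lexx.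
have up_ge0 f : neighbor_fun f -> f 0 <= f x + sigma.
  by move=> nf; rewrite (@le_trans _ _ (f x)) ?lerDl// neighbor_fun_le.
apply: subset_itvScc; rewrite bnd_simp.
- have [lo0 loK] := neighbor_invP npsi (lo_ge0 psi).
  rewrite (neighbor_inv_le nphi)// ge_max neighbor_fun_le// lo0/=.
  have lo_le_x : neighbor_inv psi (Num.max (psi 0) (psi x - sigma)) <= x.
    by rewrite (neighbor_inv_le npsi)// ge_max neighbor_fun_le// x0; lra.
  have := le_inc _ _ lo0 lo_le_x; rewrite loK.
  have : psi x - sigma <= Num.max (psi 0) (psi x - sigma).
    by rewrite le_max lexx orbT.
  lra.
- have [up0 upK] := neighbor_invP npsi (up_ge0 _ npsi).
  rewrite (neighbor_inv_ge nphi)//; last exact: up_ge0.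
  have x_le_up : x <= neighbor_inv psi (psi x + sigma).
    by rewrite (neighbor_inv_ge npsi)//; [lra|exact: up_ge0].
  have := le_inc _ _ x0 x_le_up; rewrite upK; lra.
Qed.

End NeighborFunctions.

Theorem theorem5p7 (R : realType) (psiA psiB : R -> R) (sigmaA sigmaB : R) :
  neighbor_fun psiA -> neighbor_fun psiB -> 0 < sigmaA -> 0 < sigmaB ->
  ae_C1 psiA /\ ae_C1 psiB /\
  neighbor_fun (psi_star psiA psiB sigmaA sigmaB) /\
  (forall x : R, 0 <= x ->
     uncertainty_interval psiA sigmaA x
       `<=` uncertainty_interval (psi_star psiA psiB sigmaA sigmaB) 1 x /\
     uncertainty_interval psiB sigmaB x
       `<=` uncertainty_interval (psi_star psiA psiB sigmaA sigmaB) 1 x).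
Proof.
move=> nA nB sA0 sB0.
have slopeA := neighbor_slope_div sA0 (neighbor_fun_slope nA).
have slopeB := neighbor_slope_div sB0 (neighbor_fun_slope nB).
have slope := neighbor_slope_min slopeA slopeB.
have nA' := neighbor_fun_div nA sA0.
have nB' := neighbor_fun_div nB sB0.
have int_slope b : 0 < b -> (@lebesgue_measure R).-integrable `[0, b] (EFin \o
    fun s => Num.min (derive1 psiA s / sigmaA) (derive1 psiB s / sigmaB)).
  apply: neighbor_slope_le_integrable slope nA' _ => x x0.
  by rewrite neighbor_fun_derive1_div// ge_min lexx.
have nS := neighbor_slope_Rintegral slope int_slope.
have derive1S x (x0 : 0 < x) :=
  (neighbor_slope_derive1_Rintegral slope x0 int_slope).2.
split; first exact: neighbor_fun_ae_C1.
split; first exact: neighbor_fun_ae_C1.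
split=> // x x0; split; rewrite -uncertainty_interval_div//;
  apply: uncertainty_interval_subset => // y y0;
  by rewrite derive1S// neighbor_fun_derive1_div// ge_min lexx ?orbT.
Qed.
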